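(* Let $F$ be a field of characteristic zero, let $n\ge 2$, and let $A=BT(n-1,1;F)$ with the grading induced by the Di Vincenzo--Vasilovsky $\mathbb{Z}_n$-grading of $M_n(F)$. The graded polynomial identities of $A$ follow from (1) $[x_1,x_2]=0$, where $\deg(x_1)=\deg(x_2)=0$; (2) $x_1x_2x_3-x_3x_2x_1=0$, where $\deg(x_1)=-\deg(x_2)=\deg(x_3)$; (3) the monomial identities of $A$ of degree $n$, i.e., the monomials $x_1\cdots x_n$ such that $\deg(x_i)\ne 0$ for all $1\le i\le n$ and $\sum_{t=r}^{s}\deg(x_t)\neq 0$ in $\mathbb{Z}_n$ for all $1\le r<s\le n-1$. Moreover, such identities form a minimal basis for the graded identities of $A$.
   Context: All algebras are associative and unitary. $BT(n-1,1;F)$ is the subalgebra of $M_n(F)$ of block-upper-triangular matrices with diagonal blocks of sizes $n-1$ and $1$, i.e. the matrices whose $(n,j)$-entry is $0$ for all $j<n$. The Di Vincenzo--Vasilovsky grading is $M_n(F)=\bigoplus_{t\in\mathbb{Z}_n}M_n^{(t)}$, where $M_n^{(t)}$ is the span of the elementary matrices $e_{ij}$ with $j-i\equiv t\pmod n$. $F\langle X|\mathbb{Z}_n\rangle$ is the free associative $\mathbb{Z}_n$-graded algebra on $X=\bigcup_{g\in\mathbb{Z}_n}X^g$, where the $X^g$ are disjoint countable sets of variables; variables in $X^g$ have degree $g$. A polynomial $f(x_1,\dots,x_t)\in F\langle X|\mathbb{Z}_n\rangle$ is a graded polynomial identity of a $\mathbb{Z}_n$-graded algebra $A$ if $f(a_1,\dots,a_t)=0$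 whenever $a_k\in A^{\deg(x_k)}$ for all $k$; $T_{\mathbb{Z}_n}(A)$ is the ideal of all of them. A monomial identity is a monomial that is a graded polynomial identity. A $T_{\mathbb{Z}_n}$-ideal is an ideal of $F\langle X|\mathbb{Z}_n\rangle$ invariant under all degree-preserving algebra endomorphisms; a polynomial follows from a set if it lies in the $T_{\mathbb{Z}_n}$-ideal generated by the set. A basis of the graded identities of $A$ is a set generating $T_{\mathbb{Z}_n}(A)$ as a $T_{\mathbb{Z}_n}$-ideal; it is minimal if no proper subset is a basis. In (1)--(3) the variables are distinct, and one polynomial is taken for each admissible choice of the degrees of the variables.
   Formalization: Minimality fails for the full list: (2) with all degrees 0 follows from (1), and for n=2 all of (2) follows from (1) and (3). Minimality is therefore stated for (1), (2) with deg(x_1)≠0, (3) when n≥3, and for (1), (3) when n=2. *)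

(* Defs.v *)
(* Mathematical Components, with the free algebra F<X> taken from multinomials
   as the monoid algebra {malg F[{fmonom X}]} of the free monoid on X. *)
From HB Require Import structures.
From mathcomp Require Import all_boot all_order all_algebra.
From mathcomp Require Import classical_sets.
From mathcomp Require Import finmap.
From mathcomp.multinomials Require Import monalg.

Set Implicit Arguments.
Unset Strict Implicit.
Unset Printing Implicit Defensive.

Import GRing.Theory.
Local Open Scope ring_scope.
Local Open Scope classical_set_scope.

(* The grading group Z_n is 'Z_n, which is Z/nZ only for 1 < n. *)

Section FreeGradedAlgebra.

Variables (F : fieldType) (n : nat).

(* The variable (g, k) is the k-th variable of degree g. *)
Definition gvar := ('Z_n * nat)%type.

Definition free_alg := {malg F[{fmonom gvar}]}.

Definition gX (g : 'Z_n) (k : nat) : free_alg := << fmu (g, k) >>.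

Definition mon_deg (w : {fmonom gvar}) : 'Z_n := \sum_(x <- (w : seq gvar)) x.1.

Definition homogeneous (g : 'Z_n) (f : free_alg) : Prop :=
  forall w, w \in msupp f -> mon_deg w = g.

Definition degree_preserving (phi : free_alg -> free_alg) : Prop :=
  forall g f, homogeneous g f -> homogeneous g (phi f).

Definition two_sided_ideal (I : set free_alg) : Prop :=
  [/\ I 0, forall f g, I f -> I g -> I (f + g),
      forall h f, I f -> I (h * f) & forall h f, I f -> I (f * h)].

Definition T_ideal (I : set free_alg) : Prop :=
  two_sided_ideal I /\
  forall phi : {lrmorphism free_alg -> free_alg},
    degree_preserving phi -> forall f, I f -> I (phi f).

Definition T_ideal_gen (S : set free_alg) : set free_alg :=
  [set f | forall I, T_ideal I -> S `<=` I -> I f].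

(* Substitution x := a x.  The codomain is a matrix ring of arbitrary size,
   which is only a pzRingType, so that monalg's mmap does not apply. *)
Definition gsubst (a : gvar -> 'M[F]_n) (f : free_alg) : 'M[F]_n :=
  \sum_(w <- msupp f) f@_w *: \prod_(x <- (w : seq gvar)) a x.

(* A graded subalgebra of M_n(F) is given by its homogeneous components. *)
Definition graded_identities (A : 'Z_n -> set 'M[F]_n) : set free_alg :=
  [set f | forall a : gvar -> 'M[F]_n,
             (forall x, A x.1 (a x)) -> gsubst a f = 0].

Definition graded_basis (A : 'Z_n -> set 'M[F]_n) (S : set free_alg) : Prop :=
  T_ideal_gen S = graded_identities A.

Definition minimal_graded_basis
    (A : 'Z_n -> set 'M[F]_n) (S : set free_alg) : Prop :=
  graded_basis A S /\ forall S', S' `<` S -> ~ graded_basis A S'.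

(* Rows and columns are numbered from 0, which does not change j - i. *)
Definition DV_grading (t : 'Z_n) : {vspace 'M[F]_n} :=
  (\sum_(p : 'I_n * 'I_n | (p.2 : nat)%:R - (p.1 : nat)%:R == t)
      <[delta_mx p.1 p.2]>)%VS.

Definition BT : set 'M[F]_n :=
  [set M | forall i j : 'I_n, i = n.-1 :> nat -> (j < n.-1)%N -> M i j = 0].

Definition BT_grading (t : 'Z_n) : set 'M[F]_n :=
  BT `&` [set M | M \in DV_grading t].

Definition comm_identity : free_alg := gX 0 0%N * gX 0 1%N - gX 0 1%N * gX 0 0%N.

Definition swap_identity (g : 'Z_n) : free_alg :=
  gX g 0%N * gX (- g) 1%N * gX g 2%N - gX g 2%N * gX (- g) 1%N * gX g 0%N.

Definition multilinear_monomial (d : 'I_n -> 'Z_n) : free_alg :=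
  \prod_(i < n) gX (d i) i.

(* d i is the degree of the (i + 1)-st variable, so r < s < n.-1 here is
   1 <= r < s <= n - 1 with variables numbered from 1. *)
Definition admissible (d : 'I_n -> 'Z_n) : Prop :=
  (forall i, d i != 0) /\
  forall r s : 'I_n, (r < s < n.-1)%N ->
    \sum_(t < n | (r <= t <= s)%N) d t != 0.

Definition comm_identities : set free_alg := [set comm_identity].

Definition swap_identities : set free_alg :=
  [set swap_identity g | g in [set: 'Z_n]].

(* swap_identity 0 is a consequence of comm_identity:
   xyz - zyx = x[y, z] + [x, z]y + z[x, y]. *)
Definition nonzero_swap_identities : set free_alg :=
  [set swap_identity g | g in [set g : 'Z_n | g != 0]].

Definition monomial_identities : set free_alg :=
  [set multilinear_monomial d | d in [set d : 'I_n -> 'Z_n | admissible d]].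

End FreeGradedAlgebra.

Arguments BT_grading : clear implicits.
Arguments comm_identities : clear implicits.
Arguments swap_identities : clear implicits.
Arguments nonzero_swap_identities : clear implicits.
Arguments monomial_identities : clear implicits.

(* Main.v *)
Require Import Defs.
From HB Require Import structures.
From mathcomp Require Import all_boot all_order all_algebra.
From mathcomp Require Import boolp classical_sets.
From mathcomp Require Import finmap.
From mathcomp.multinomials Require Import monalg.

Set Implicit Arguments.
Unset Strict Implicit.
Unset Printing Implicit Defensive.

Import Order.TTheory GRing.Theory Num.Theory.
Local Open Scope ring_scope.
Local Open Scope classical_set_scope.

(** Reading a monomial from left to right and adding up degrees, one gets a
    walk on the vertex set Z_n: a letter x read at the vertex i is an edge from
    i to i + deg x.  A homogeneous matrix of degree t only has entries at the
    positions (i, i + t), so entry (i, j) of the product of the matrices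
    substituted for the letters is the product of their entries along the walk
    from i, and in block triangular matrices it vanishes as soon as an edge
    other than a loop leaves the last vertex.  For generic matrices this entry
    is a commutative monomial that records the multiset of labelled edges of
    the walk.  Three facts then give generation.

    - Two walks from the same vertex with the same multiset of edges are two
      Eulerian trails of one graph, and one is turned into the other by
      exchanging the factors a and c in a b c with deg a = deg c = - deg b,
      where the factors may be empty: [eulerian_swap_eq].  These exchanges are
      consequences of the commutator and the exchange identities.

    - A monomial is an identity exactly when its walk leaves every vertex of
      Z_n by some edge other than a loop.  Cutting the walk at the first visits to the n
      vertices writes it as y_1 ... y_n v, where y_1 ... y_n is a substitution
      instance of a listed monomial identity: [covers_cut].

    - In an arbitrary identity, the coefficients of the monomials that share
      a nonzero commutative monomial add up to zero ([ids_class_sum]), because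
      distinct commutative monomials are linearly independent functions.
      Hence a whole class of monomials can be cancelled by exchanges, and
      after finitely many cancellations only monomial identities are left:
      [ids_in_ideal].

    For minimality, the polynomials all of whose consequences have coefficient
    zero at a fixed word w form a T-ideal, [coef_ideal].  For each listed
    identity, w is taken to be a monomial of that identity.  The other listed
    identities fall in [coef_ideal w], because w has no factor into which their
    monomials could be substituted, except in ways that make the commutator
    vanish. *)

(** * Eulerian trails *)
Section Walks.
Variables (G : zmodType) (T : eqType) (d : T -> G).
Implicit Types (i p : G) (x : T) (u v w a b c : seq T).

Definition wdeg w : G := \sum_(x <- w) d x.

(** As a multiset, this is the commutative monomial found in row i of the
    product of the generic matrices of the letters of w. *)
Fixpoint edges i w : seq (G * T) :=
  if w is x :: w' then (i, x) :: edges (i + d x) w' else [::].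

(** The congruence of words induced by the commutator and the exchange
    identities.  Since a, b and c may be empty, a single rule covers both:
    with b empty it lets words of degree zero commute. *)
Inductive swap_eq : seq T -> seq T -> Prop :=
| SwapRefl w : swap_eq w w
| SwapStep u a b c v w :
    wdeg a = - wdeg b -> wdeg c = - wdeg b ->
    swap_eq (u ++ c ++ b ++ a ++ v) w -> swap_eq (u ++ a ++ b ++ c ++ v) w.

Lemma wdeg_nil : wdeg [::] = 0. Proof. exact: big_nil. Qed.

Lemma wdeg1 x : wdeg [:: x] = d x. Proof. exact: big_seq1. Qed.

Lemma wdeg_nth x0 w : wdeg w = \sum_(0 <= k < size w) d (nth x0 w k).
Proof. exact: big_nth. Qed.

Lemma wdeg_eq0 w : {in w, forall x, d x = 0} -> wdeg w = 0.
Proof. by move=> w0; apply: big1_seq => x /andP[_]; apply: w0. Qed.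

Lemma wdeg_cons x w : wdeg (x :: w) = d x + wdeg w.
Proof. exact: big_cons. Qed.

Lemma wdeg_cat u v : wdeg (u ++ v) = wdeg u + wdeg v.
Proof. exact: big_cat. Qed.

Lemma edges_cat i u v : edges i (u ++ v) = edges i u ++ edges (i + wdeg u) v.
Proof.
elim: u i => [|x u IHu] i /=; first by rewrite wdeg_nil addr0.
by rewrite IHu wdeg_cons addrA.
Qed.

Lemma edges_shift i j w :
  edges (i + j) w = [seq (i + e.1, e.2) | e <- edges j w].
Proof. by elim: w j => //= x w IHw j; rewrite -addrA IHw. Qed.

Lemma size_edges i w : size (edges i w) = size w.
Proof. by elim: w i => //= x w IHw i; rewrite IHw. Qed.

Lemma edge_split i w e : e \in edges i w ->
  exists a b, w = a ++ e.2 :: b /\ e.1 = i + wdeg a.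
Proof.
elim: w i => //= x w IHw i; rewrite inE => /orP[/eqP->|/IHw[a [b [-> ->]]]].
  by exists [::], w; rewrite wdeg_nil addr0.
by exists (x :: a), b; rewrite wdeg_cons addrA.
Qed.

Lemma sum_edges i w : \sum_(e <- edges i w) d e.2 = wdeg w.
Proof.
elim: w i => [|x w IHw] i /=; first by rewrite big_nil wdeg_nil.
by rewrite big_cons IHw wdeg_cons.
Qed.

Lemma swap_eq_cons x u v : swap_eq u v -> swap_eq (x :: u) (x :: v).
Proof.
elim=> [w|u' a b c v' w Da Dc _ IH]; first exact: SwapRefl.
exact: (SwapStep (u := x :: u') Da Dc).
Qed.

Lemma swap_eq_trans v u w : swap_eq u v -> swap_eq v w -> swap_eq u w.
Proof. by elim=> // u' a b c v' w' Da Dc _ IH /IH; apply: SwapStep. Qed.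

(** Both orders of the three factors are trails through the same vertices:
    a and c both run from p to q, and b runs back from q to p. *)
Lemma swap_step_edges i u a b c v :
    wdeg a = - wdeg b -> wdeg c = - wdeg b ->
  perm_eq (edges i (u ++ a ++ b ++ c ++ v)) (edges i (u ++ c ++ b ++ a ++ v)).
Proof.
move=> Da Dc; rewrite !edges_cat Da Dc !addrNK perm_cat2l.
apply/permP=> P; rewrite !count_cat addnCA [RHS]addnCA.
by congr (_ + _)%N; apply: addnCA.
Qed.

Lemma swap_eq_edges i u v : swap_eq u v -> perm_eq (edges i u) (edges i v).
Proof.
elim=> // u' a b c v' w Da Dc _; apply: perm_trans; exact: swap_step_edges.
Qed.

Fixpoint vertices i w : seq G :=
  i :: (if w is x :: w' then vertices (i + d x) w' else [::]).

Lemma vertex_split i w p : p \in vertices i w ->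
  exists a b, w = a ++ b /\ p = i + wdeg a.
Proof.
elim: w i => [|x w IHw] i /=; rewrite inE.
  by move=> /eqP->; exists [::], [::]; rewrite wdeg_nil addr0.
case/orP=> [/eqP->|/IHw[a [b [-> ->]]]].
  by exists [::], (x :: w); rewrite wdeg_nil addr0.
by exists (x :: a), b; rewrite wdeg_cons addrA.
Qed.

Lemma vertices_start i w : i \in vertices i w.
Proof. by case: w => *; rewrite inE eqxx. Qed.

Lemma edge_vertices i w e : e \in edges i w ->
  e.1 \in vertices i w /\ e.1 + d e.2 \in vertices i w.
Proof.
elim: w i => //= x w IHw i; rewrite !inE => /orP[/eqP->/=|/IHw[-> ->]].
  by rewrite eqxx vertices_start orbT.
by rewrite !orbT.
Qed.

Lemma edges_confined (V : {pred G}) i w : i \in V ->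
    {in edges i w, forall e, e.1 \in V -> e.1 + d e.2 \in V} ->
  {in edges i w, forall e, e.1 \in V}.
Proof.
elim: w i => //= x w IHw i Vi closedV e.
rewrite inE => /orP[/eqP->//|]; apply: (IHw (i + d x)).
  by apply: (closedV (i, x)) => //; rewrite inE eqxx.
by move=> e' e'w; apply: closedV; rewrite inE e'w orbT.
Qed.

(** Write w = a x b with a a closed walk at i.  If b meets a vertex of a, both
    walks can be cut there and an exchange brings x to the front.  Otherwise
    the walk x u, once it has used the edge x, is trapped among the vertices of
    b, and it can never use the first edge of a, which it shares with w. *)
Lemma swap_to_front i w x u : perm_eq (edges i w) (edges i (x :: u)) ->
  exists v, swap_eq w (x :: v).
Proof.
move=> eq_wu.
have /edge_split[a [b [/= Dw]]]: (i, x) \in edges i w.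
  by rewrite (perm_mem eq_wu) inE eqxx.
rewrite -[LHS]addr0 => /addrI/esym Da.
case: a => [|y a] in Dw Da *; first by exists b; rewrite Dw; apply: SwapRefl.
have [Dy|neq_yx] := eqVneq y x.
  by exists (a ++ x :: b); rewrite Dw Dy; apply: SwapRefl.
set Va := vertices i (y :: a); set Vb := vertices (i + d x) b.
have [/hasP[c /= /vertex_split[b1 [b2 [Db Dc]]] Va_c]|disjab] := boolP (has (mem Va) Vb).
  have [a1 [a2 [Da12 Dc']]] := vertex_split Va_c.
  exists (b1 ++ a2 ++ a1 ++ b2).
  have Dwx: w = [::] ++ a1 ++ a2 ++ (x :: b1) ++ b2.
    by rewrite Dw Da12 Db -!catA.
  have a12_0: wdeg a1 + wdeg a2 = 0 by rewrite -wdeg_cat -Da12.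
  have Da1: wdeg a1 = - wdeg a2 by apply/eqP; rewrite -subr_eq0 opprK a12_0.
  rewrite Dwx; apply: SwapStep => //; last exact: SwapRefl.
  by rewrite -Da1 wdeg_cons; apply: (addrI i); rewrite -Dc' Dc addrA.
have confined: {in edges (i + d x) u, forall e, e.1 \in Vb}.
  apply: edges_confined; first exact: vertices_start.
  move=> e eu Vb_e.
  have: e \in edges i w by rewrite (perm_mem eq_wu) inE eu orbT.
  rewrite Dw edges_cat mem_cat Da addr0 => /orP[/edge_vertices[Va_e _]|].
    by case/negP: disjab; apply/hasP; exists e.1.
  rewrite inE => /orP[/eqP De|/edge_vertices[] //].
  case/negP: disjab; apply/hasP; exists e.1 => //; rewrite De.
  exact: vertices_start.
have: (i, y) \in edges i (x :: u) by rewrite -(perm_mem eq_wu) Dw inE eqxx.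
rewrite inE xpair_eqE eqxx (negPf neq_yx) /= => /confined Vb_i.
by case/negP: disjab; apply/hasP; exists i => //; apply: vertices_start.
Qed.

(** The first edges are made equal by [swap_to_front] and then cancelled. *)
Theorem eulerian_swap_eq i w w' :
  perm_eq (edges i w) (edges i w') -> swap_eq w w'.
Proof.
elim: w' i w => [|x w' IH] i w eq_ww'.
  move/perm_size: eq_ww'; rewrite !size_edges /= => /size0nil->.
  exact: SwapRefl.
have [v wv] := swap_to_front eq_ww'; apply: swap_eq_trans (wv) _.
apply/swap_eq_cons/(IH (i + d x)); rewrite -(perm_cons (i, x)).
by apply: perm_trans eq_ww'; rewrite perm_sym; apply: (swap_eq_edges i wv).
Qed.

End Walks.

(** * Walks that leave every vertex *)
Section Covering.
Variables (G : finZmodType) (T : eqType) (d : T -> G).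
Implicit Types (p c : G) (x : T) (u v w a b : seq T).

Definition covers (seen : seq G) p w :=
  forall c, c \notin seen -> exists2 x, (c, x) \in edges d p w & d x != 0.

Definition partial_sum (f : nat -> G) r s := \sum_(r <= t < s) f t.

Lemma first_escape (seen : seq G) p w :
    has [predC seen] (vertices d p w) ->
  exists a b, [/\ w = a ++ b, p + wdeg d a \notin seen
                & {in edges d p a, forall e, e.1 \in seen}].
Proof.
elim: w p => [|x w IHw] p /=.
  by rewrite orbF => ps; exists [::], [::]; rewrite wdeg_nil addr0.
have [ps /= hasw|ps _] := boolP (p \in seen); last first.
  by exists [::], (x :: w); rewrite wdeg_nil addr0.
have [a [b [-> qs abs]]] := IHw _ hasw.
exists (x :: a), b; rewrite wdeg_cons addrA; split=> // e.
by rewrite inE => /orP[/eqP->//|]; apply: abs.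
Qed.

(** The cuts are made at the first visits.  The list seen contains the cut
    points already met, without the current one p, and k + 1 counts the
    vertices outside seen; the distinctness of the cut points is the
    nonvanishing of the partial sums of degrees.  The last factor stops after
    an edge out of the last cut point, which ensures that its degree is not
    zero. *)
Lemma covers_cut k (seen : seq G) p w :
    uniq (p :: seen) -> (size seen + k.+1 = #|G|)%N -> covers seen p w ->
  exists ys v,
    [/\ w = flatten ys ++ v, size ys = k.+1,
        {in ys, forall y, wdeg d y != 0},
        forall s, (s <= k)%N ->
          p + partial_sum (fun t => wdeg d (nth [::] ys t)) 0 s \notin seen
      & forall r s, (r < s <= k)%N ->
          partial_sum (fun t => wdeg d (nth [::] ys t)) r s != 0].
Proof.
elim: k => [|k IHk] in seen p w *.
  move=> /andP[ps _] _ cov; have [x /edge_split[a [b [/= Dw Dp]]] dx] := cov p ps.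
  have a0: wdeg d a = 0 by apply: (addrI p); rewrite -Dp addr0.
  exists [:: rcons a x], b; split=> //=.
  - by rewrite cats0 cat_rcons.
  - move=> y; rewrite inE => /eqP->.
    by rewrite -cats1 wdeg_cat a0 wdeg_cons wdeg_nil addr0 add0r.
  - by move=> s; rewrite leqn0 => /eqP->; rewrite /partial_sum big_geq ?addr0.
  by move=> r s; rewrite leqn0 => /andP[/[swap]/eqP->].
move=> uniq_ps size_seen cov.
have /first_escape[a [b [Dw qs ea]]]:
  has [predC p :: seen] (vertices d p w).
  have /subsetPn[c _ cs]: ~~ ([set: G]%SET \subset (p :: seen)).
    apply/negP=> /subset_leq_card; rewrite cardsT (card_uniqP uniq_ps) /=.
    by rewrite -size_seen !addnS ltnS ltnNge leq_addr.
  apply/hasP; exists c => //.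
  have [|x /edge_vertices[]//] := cov c.
  by apply: contra cs => cs; rewrite inE cs orbT.
set q := p + wdeg d a in qs.
have uniq_qps: uniq (q :: p :: seen) by rewrite cons_uniq qs.
(* The edges of a leave vertices that were already seen, so those required
   at the remaining vertices occur in b. *)
have covq: covers (p :: seen) q b.
  move=> c cps; have [|x xw dx] := cov c.
    by apply: contra cps => cs; rewrite inE cs orbT.
  exists x => //; move: xw; rewrite Dw edges_cat mem_cat => /orP[/ea /=|//].
  by rewrite (negPf cps).
have [|ys [v [Db size_ys ysN0 ys_new ys_sum]]] := IHk _ _ _ uniq_qps _ covq.
  by rewrite /= -size_seen !addnS.
have a_neq0: wdeg d a != 0.
  apply: contra qs => /eqP a0.
  by rewrite /q a0 addr0 inE eqxx.
have shift r s : partial_sum (fun t => wdeg d (nth [::] (a :: ys) t)) r.+1 s.+1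
    = partial_sum (fun t => wdeg d (nth [::] ys t)) r s.
  by rewrite /partial_sum big_add1.
have shift0 s : partial_sum (fun t => wdeg d (nth [::] (a :: ys) t)) 0 s.+1
    = wdeg d a + partial_sum (fun t => wdeg d (nth [::] ys t)) 0 s.
  by rewrite {1}/partial_sum big_nat_recl.
exists (a :: ys), v; split=> //=.
- by rewrite Dw Db catA.
- by rewrite size_ys.
- by move=> y; rewrite inE => /orP[/eqP->//|]; apply: ysN0.
- case=> [_|s s_k]; first by rewrite /partial_sum big_geq // addr0; case/andP: uniq_ps.
  rewrite shift0 addrA.
  by have:= ys_new s s_k; rewrite inE negb_or => /andP[].
case=> [|r] [|s] // /andP[rs sk]; last by rewrite shift ys_sum //; apply/andP.
have:= ys_new s sk; rewrite inE negb_or => /andP[+ _]; apply: contra => /eqP D0.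
by rewrite /q -addrA -shift0 D0 addr0.
Qed.

End Covering.

(** * Linear independence of commutative monomials *)
Section PrimeCode.
Variable E : countType.
Implicit Types (e : E) (s t : seq E).

(** Injectivity is what counts: [prime_above] need not give the next prime. *)
Fixpoint nth_prime k : nat :=
  if k is k'.+1 then s2val (prime_above (nth_prime k')) else 2%N.

Lemma nth_prime_prime k : prime (nth_prime k).
Proof. by case: k => //= k; case: prime_above. Qed.

Lemma nth_prime_inj : injective nth_prime.
Proof.
apply: incn_inj; apply: leq_mono; apply: homo_ltn; first exact: ltn_trans.
by move=> k /=; case: prime_above.
Qed.

Definition prime_code s : nat := (\prod_(e <- s) nth_prime (choice.pickle e))%N.

Lemma logn_prime_code s e :
  logn (nth_prime (choice.pickle e)) (prime_code s) = count_mem e s.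
Proof.
have gt0 t : (0 < prime_code t)%N.
  by apply: prodn_gt0 => x; apply/prime_gt0/nth_prime_prime.
elim: s => [|x s IHs]; first by rewrite /prime_code big_nil logn1.
rewrite /prime_code big_cons lognM ?gt0 ?prime_gt0 ?nth_prime_prime //.
rewrite -/(prime_code s) IHs /= logn_prime ?nth_prime_prime //.
by rewrite (inj_eq nth_prime_inj) (inj_eq (pcan_inj choice.pickleK)) eq_sym.
Qed.

(** By unique factorization the code is a faithful invariant of multisets. *)
Lemma prime_code_perm s t : (prime_code s == prime_code t) = perm_eq s t.
Proof.
apply/eqP/idP => [eq_st|]; last by move=> st; apply: perm_big.
by apply/allP => e _ /=; rewrite -!logn_prime_code eq_st.
Qed.

End PrimeCode.

Section PowerSums.
Variables (F : fieldType) (T : eqType).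

(** By linearity the hypothesis extends from powers to every polynomial p in
    v w; p is chosen to vanish at all values other than v0. *)
Lemma power_sums_class_sum (s : seq T) (c v : T -> F) (v0 : F) :
    (forall k, \sum_(w <- s) c w * v w ^+ k = 0) ->
  \sum_(w <- s | v w == v0) c w = 0.
Proof.
move=> sum0; pose p := \prod_(w <- s | v w != v0) ('X - (v w)%:P).
have p_v0: p.[v0] != 0.
  rewrite horner_prod; elim/big_rec: _ => [|w x wv0 IH]; first exact: oner_neq0.
  by rewrite mulf_neq0 // hornerXsubC subr_eq0 eq_sym.
apply: (mulIf p_v0); rewrite mul0r mulr_suml.
transitivity (\sum_(w <- s) c w * p.[v w]).
  rewrite [RHS](bigID (fun w => v w == v0)) /= [X in _ + X]big_seq_cond.
  rewrite [X in _ + X]big1 => [|w /andP[ws wv0]].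
    by rewrite addr0; apply: eq_bigr => w /eqP->.
  by rewrite horner_prod (big_rem w) //= wv0 hornerXsubC subrr mul0r mulr0.
under eq_bigr do rewrite horner_coef mulr_sumr.
rewrite exchange_big big1 //= => k _.
under eq_bigr do rewrite mulrCA.
by rewrite -mulr_sumr sum0 mulr0.
Qed.

End PowerSums.

(** * The free algebra and its substitutions *)
Lemma sum_scale_shift (R : pzRingType) (V : lmodType R) (T : Type) (s : seq T)
    (P : pred T) (c : T -> R) (u : T -> V) (v : V) :
    \sum_(w <- s | P w) c w = 0 ->
  \sum_(w <- s | P w) c w *: (u w - v) = \sum_(w <- s | P w) c w *: u w.
Proof.
move=> c0; under eq_bigr do rewrite scalerBr.
by rewrite sumrB -scaler_suml c0 scale0r subr0.
Qed.

Lemma commutator_shift (R : pzRingType) (c d a b : R) :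
    (forall x, c * x = x * c) -> (forall x, d * x = x * d) ->
  (a - c) * (b - d) - (b - d) * (a - c) = a * b - b * a.
Proof.
have shift (e x y : R) : (forall z, e * z = z * e) ->
    (x - e) * y - y * (x - e) = x * y - y * x.
  by move=> eC; rewrite mulrBl mulrBr eC opprB subrKA.
by move=> cC dC; rewrite shift // -opprB shift // opprB.
Qed.

Lemma sandwichMr (R : pzRingType) (p f h q : R) :
  p * (f * h) * q = p * f * (h * q).
Proof. by rewrite !mulrA. Qed.

(** The word w as an element of the free algebra; it is locked so that failing
    unifications do not unfold the multiplication of the monoid algebra. *)
HB.lock Definition mono (F : fieldType) (I : choiceType) (w : seq I) :
  {malg F[{fmonom I}]} := << FMonom w >>.

Section FreeAlgebra.
Variables (F : fieldType) (I : choiceType).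
Local Notation mono := (@mono F I).
Local Notation alg := {malg F[{fmonom I}]}.
Implicit Types (f g h p q : alg) (u v w : seq I) (x : I).

Lemma free_scaleAr (c : F) f g : c *: (f * g) = f * (c *: g).
Proof.
rewrite [f in LHS]monalgE [f in RHS]monalgE [g in LHS]monalgE [g in RHS]monalgE.
rewrite 2!mulr_suml 2!scaler_sumr; apply: eq_bigr => u _.
rewrite !mulr_sumr scaler_sumr; apply: eq_bigr => v _.
rewrite -!mul_malgC.
rewrite !malgM_def !fgmulUU !mul1m; congr mkmalgU.
by rewrite mulrCA.
Qed.

Lemma mono_nil : mono [::] = 1.
Proof. by rewrite mono.unlock -fmoneE. Qed.

Lemma mono_cat u v : mono (u ++ v) = mono u * mono v.
Proof. by rewrite mono.unlock malgM_def fgmulUU mulr1 /mmul /mul /= fmmulE. Qed.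

Lemma mono_letter x : << fmu x >> = mono [:: x].
Proof. by rewrite mono.unlock fmuE. Qed.

Lemma mono_prod w : mono w = \prod_(x <- w) << fmu x >>.
Proof.
elim: w => [|x w IHw]; first by rewrite big_nil mono_nil.
by rewrite big_cons -IHw mono_letter -mono_cat.
Qed.

Lemma mono_flatten ws : mono (flatten ws) = \prod_(w <- ws) mono w.
Proof.
elim: ws => [|w ws IH] /=; first by rewrite big_nil mono_nil.
by rewrite big_cons mono_cat IH.
Qed.

Lemma mono_coeff u v : (mono u)@_(FMonom v) = (u == v)%:R.
Proof. by rewrite mono.unlock mcoeffU1 fmP. Qed.

Lemma msupp_mono w : msupp (mono w) = [fset FMonom w]%fset.
Proof. by rewrite mono.unlock msuppU1. Qed.

Lemma mono_expansion f : f = \sum_(w <- msupp f) f@_w *: mono w.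
Proof.
rewrite {1}[f]monalgE; apply: eq_bigr => w _.
by rewrite -mul_malgC malgM_def mono.unlock fmK fgmulUU mulr1 mul1m.
Qed.

Lemma mcoeff_restrict f (P : pred {fmonom I}) (w : {fmonom I}) :
  (\sum_(u <- msupp f | P u) f@_u *: mono u)@_w = if P w then f@_w else 0.
Proof.
rewrite [f in RHS]mono_expansion big_mkcond 2!raddf_sum /=.
have term (u : {fmonom I}) : (f@_u *: mono u)@_w = if u == w then f@_u else 0.
  rewrite mcoeffZ; have := mono_coeff u w; rewrite fmK -fmP => ->.
  by case: eqP; rewrite ?mulr1 ?mulr0.
case Pw: (P w); [apply: eq_bigr => u _ | apply: big1 => u _].
  case: ifP => // Pu; rewrite mcoeff0 term.
  by case: eqP => // Du; rewrite Du Pw in Pu.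
case: ifP => [Pu|]; last by rewrite mcoeff0.
by rewrite term; case: eqP => // Du; rewrite Du Pw in Pu.
Qed.

Lemma msupp_prod (fs : seq alg) (w : {fmonom I}) :
    w \in msupp (\prod_(f <- fs) f) ->
  exists2 zs, w = flatten zs :> seq I
     & all2 (fun z f => FMonom z \in msupp f) zs fs.
Proof.
elim: fs w => [|f fs IHfs] w.
  rewrite big_nil -mono_nil msupp_mono inE => /eqP->.
  by exists [::].
rewrite big_cons => /msuppM_le[u [v [fu /IHfs[zs Dv zsfs] ->]]].
by exists (val u :: zs); rewrite /= ?fmM ?Dv ?zsfs ?andbT ?fmK.
Qed.

Lemma coeff_sandwichD p f g q (k : {fmonom I}) :
  (p * (f + g) * q)@_k = (p * f * q)@_k + (p * g * q)@_k.
Proof. by rewrite mulrDr mulrDl mcoeffD. Qed.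

Lemma coeff_sandwichB p f g q (k : {fmonom I}) :
  (p * (f - g) * q)@_k = (p * f * q)@_k - (p * g * q)@_k.
Proof. by rewrite mulrBr mulrBl mcoeffB. Qed.

Lemma coeff_sandwichMl p h f q (k : {fmonom I}) :
  (p * (h * f) * q)@_k = ((p * h) * f * q)@_k.
Proof. by rewrite [p * (h * f)]mulrA. Qed.

Lemma coeff_sandwichMr p h f q (k : {fmonom I}) :
  (p * (f * h) * q)@_k = (p * f * (h * q))@_k.
Proof. by rewrite sandwichMr. Qed.

Lemma commutator_sub_scalar (c d : F) f g :
  (f - c *: 1) * (g - d *: 1) - (g - d *: 1) * (f - c *: 1) = f * g - g * f.
Proof.
have scalar_central e h : e *: 1 * h = h * (e *: 1).
  by rewrite -free_scaleAr -scalerAl mul1r mulr1.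
by apply: commutator_shift => h; apply: scalar_central.
Qed.

Section Evaluation.
Variables (S : lalgType F) (h : I -> S).

(** The universal property of the free algebra, with values in an algebra S;
    substitution of matrices and of polynomials are both instances.
    S is only an [lalgType], and the compatibility of scaling with right factors
    is an explicit hypothesis where it matters; the free algebra meets it by
    [free_scaleAr]. *)
Definition ev f : S := \sum_(w <- msupp f) f@_w *: \prod_(x <- (w : seq I)) h x.

Lemma ev_widen (D : {fset {fmonom I}}) f : (msupp f `<=` D)%fset ->
  ev f = \sum_(w <- D) f@_w *: \prod_(x <- (w : seq I)) h x.
Proof.
move=> fD; rewrite /ev (big_fset_incl _ fD) // => w _ /mcoeff_outdom->.
by rewrite scale0r.
Qed.

Lemma ev_is_linear : linear ev.
Proof.
move=> c f g; pose D := (msupp f `|` msupp g `|` msupp (c *: f + g))%fset.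
rewrite !(@ev_widen D) ?fsubsetUr //; first last.
- by rewrite /D -fsetUA fsubsetUl.
- by rewrite /D fsetUAC fsubsetUr.
rewrite scaler_sumr -big_split; apply: eq_bigr => w _ /=.
by rewrite mcoeffD mcoeffZ scalerDl scalerA.
Qed.

HB.instance Definition _ := GRing.isLinear.Build F alg S *:%R ev ev_is_linear.

Lemma ev0 : ev 0 = 0.
Proof. exact: linear0. Qed.

Lemma evD f g : ev (f + g) = ev f + ev g.
Proof. exact: linearD. Qed.

Lemma evZ c f : ev (c *: f) = c *: ev f.
Proof. exact: linearZ. Qed.

Lemma ev_sum (J : Type) (r : seq J) (f : J -> alg) :
  ev (\sum_(j <- r) f j) = \sum_(j <- r) ev (f j).
Proof. exact: linear_sum. Qed.

Lemma evU c (w : {fmonom I}) :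
  ev << c *g w >> = c *: \prod_(x <- (w : seq I)) h x.
Proof. by rewrite (ev_widen msuppU_le) big_seq_fset1 mcoeffUU. Qed.

Lemma ev_mono w : ev (mono w) = \prod_(x <- w) h x.
Proof. by rewrite mono.unlock evU scale1r. Qed.

Lemma ev_is_multiplicative :
    (forall (c : F) (y z : S), c *: (y * z) = y * (c *: z)) ->
  monoid_morphism ev.
Proof.
move=> S_scaleAr; split=> [|f g]; first by rewrite -mono_nil ev_mono big_nil.
rewrite malgME ev_sum [ev f]/ev mulr_suml; apply: eq_bigr => u _.
rewrite ev_sum [ev g]/ev mulr_sumr; apply: eq_bigr => v _.
by rewrite evU fmM big_cat -scalerAl -S_scaleAr scalerA.
Qed.

End Evaluation.

Lemma ev_comp (S : lalgType F) (h : I -> S) (phi : {lrmorphism alg -> alg}) f :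
    (forall (c : F) (y z : S), c *: (y * z) = y * (c *: z)) ->
  ev h (phi f) = ev (fun x => ev h (phi << fmu x >>)) f.
Proof.
move=> S_scaleAr; have [ev1 evM] := ev_is_multiplicative h S_scaleAr.
rewrite {1}[f]mono_expansion linear_sum ev_sum; apply: eq_bigr => w _.
rewrite linearZ evZ; congr (_ *: _).
by rewrite mono_prod rmorph_prod; apply: (big_morph _ evM ev1).
Qed.

Definition subst (h : I -> alg) : alg -> alg := ev h.

HB.instance Definition _ (h : I -> alg) :=
  GRing.isLinear.Build F alg alg *:%R (subst h) (ev_is_linear h).
HB.instance Definition _ (h : I -> alg) :=
  GRing.isMonoidMorphism.Build alg alg (subst h)
    (ev_is_multiplicative h free_scaleAr).

Lemma substB (h : I -> alg) f g : subst h (f - g) = subst h f - subst h g.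
Proof. exact: rmorphB. Qed.

Lemma substM (h : I -> alg) f g : subst h (f * g) = subst h f * subst h g.
Proof. exact: rmorphM. Qed.

Lemma subst_prod (h : I -> alg) (J : Type) (r : seq J) (f : J -> alg) :
  subst h (\prod_(j <- r) f j) = \prod_(j <- r) subst h (f j).
Proof. exact: rmorph_prod. Qed.

Lemma subst_letter (h : I -> alg) x : subst h << fmu x >> = h x.
Proof. by rewrite mono_letter [LHS]ev_mono big_seq1. Qed.

End FreeAlgebra.

(** Ring identities that are stated for abstract rings, where rewriting is
    fast, and are then instantiated in the free algebra. *)
Lemma swap_commutators (R : pzRingType) (x y z : R) :
  x * y * z - z * y * x =
    x * (y * z - z * y) + (x * z - z * x) * y + z * (x * y - y * x).
Proof. by rewrite !mulrBr mulrBl !mulrA !subrKA. Qed.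

Lemma swap_context (R : pzRingType) (u a b c v : R) :
  u * ((a * b * c - c * b * a) * v) =
    u * (a * (b * (c * v))) - u * (c * (b * (a * v))).
Proof. by rewrite mulrBl mulrBr !mulrA. Qed.

Section Homogeneous.
Variables (F : fieldType) (n : nat).
Local Notation alg := (free_alg F n).
Local Notation mono := (@mono F (gvar n)).
Local Notation subst := (@subst F (gvar n)).
Local Notation wdeg := (wdeg (@fst 'Z_n nat)).
Implicit Types (f g : alg) (t : 'Z_n) (w : seq (gvar n)).

Lemma homogeneous_mono w : homogeneous (wdeg w) (mono w).
Proof. by move=> u; rewrite msupp_mono inE => /eqP->. Qed.

Lemma homogeneous0 t : homogeneous t (0 : alg).
Proof. by move=> w; rewrite msupp0 inE. Qed.

Lemma homogeneousD t f g :
  homogeneous t f -> homogeneous t g -> homogeneous t (f + g).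
Proof.
move=> hf hg w /(fsubsetP (msuppD_le f g)); rewrite in_fsetU => /orP[/hf|/hg] //.
Qed.

Lemma homogeneousZ t c f : homogeneous t f -> homogeneous t (c *: f).
Proof. by move=> hf w /(fsubsetP (msuppZ_le c f))/hf. Qed.

Lemma homogeneousM s t f g :
  homogeneous s f -> homogeneous t g -> homogeneous (s + t) (f * g).
Proof.
move=> hf hg w /msuppM_le[u [v [/hf<- /hg<- ->]]].
by rewrite /mon_deg fmM big_cat.
Qed.

Lemma subst_degree_preserving (h : gvar n -> alg) :
  (forall x, homogeneous x.1 (h x)) -> degree_preserving (subst h).
Proof.
move=> hh t f hf; rewrite /subst /ev big_seq.
elim/big_rec: _ => [|w g wf hg]; first exact: homogeneous0.
apply: homogeneousD hg; apply: homogeneousZ; rewrite -(hf _ wf) /mon_deg.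
elim: (w : seq _) => [|x u IHu]; last by rewrite !big_cons; apply: homogeneousM.
rewrite !big_nil -[1](@mono_nil F (gvar n)) -(@wdeg_nil _ _ (@fst 'Z_n nat)).
exact: homogeneous_mono.
Qed.

(** The substitution that sends the k-th variable to the k-th word of zs, when
    the degrees agree, and all other variables to zero, which is homogeneous of
    every degree. *)
Definition word_subst (zs : seq (seq (gvar n))) (x : gvar n) : alg :=
  let z := nth [::] zs x.2 in if wdeg z == x.1 then mono z else 0.

Lemma word_subst_degree_preserving zs :
  degree_preserving (subst (word_subst zs)).
Proof.
apply: subst_degree_preserving => x; rewrite /word_subst.
by case: eqP => [<-|_]; [apply: homogeneous_mono | apply: homogeneous0].
Qed.

Lemma word_substX zs t k : wdeg (nth [::] zs k) = t ->
  subst (word_subst zs) (gX F t k) = mono (nth [::] zs k).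
Proof. by move=> Dt; rewrite [LHS]subst_letter /word_subst /= Dt eqxx. Qed.

End Homogeneous.

(** * Consequences of the listed identities *)
Section TIdeals.
Variables (F : fieldType) (n : nat) (J : set (free_alg F n)).
Hypothesis TJ : T_ideal J.
Local Notation mono := (@mono F (gvar n)).
Local Notation subst := (@subst F (gvar n)).
Local Notation word_subst := (@word_subst F n).
Local Notation wdeg := (wdeg (@fst 'Z_n nat)).
Implicit Types (a b c u v w : seq (gvar n)).

Lemma ideal_sum (T : eqType) (r : seq T) (f : T -> free_alg F n) :
  (forall x, x \in r -> J (f x)) -> J (\sum_(x <- r) f x).
Proof.
move=> Jf; case: TJ => -[J0 JD _ _] _; rewrite big_seq.
by elim/big_rec: _ => // x g /Jf; apply: JD.
Qed.

Lemma idealZ (k : F) f : J f -> J (k *: f).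
Proof. by case: TJ => -[_ _ Jl _] _ Jf; rewrite -mul_malgC; apply: Jl. Qed.

Lemma idealD f g : J f -> J g -> J (f + g).
Proof. by case: TJ => -[_ JD _ _] _; apply: JD. Qed.

Lemma idealB f g : J f -> J g -> J (f - g).
Proof. by move=> Jf Jg; rewrite -scaleN1r; apply/idealD/idealZ. Qed.

Lemma idealMl f g : J g -> J (f * g).
Proof. by case: TJ => -[_ _ Jl _] _; apply: Jl. Qed.

Lemma idealMr f g : J f -> J (f * g).
Proof. by case: TJ => -[_ _ _ Jr] _; apply: Jr. Qed.

Lemma ideal_word_subst zs f : J f -> J (subst (word_subst zs) f).
Proof.
by case: TJ => _ Jphi; apply: Jphi; apply: word_subst_degree_preserving.
Qed.

Lemma comm_in_ideal a b : J (comm_identity F n) ->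
  wdeg a = 0 -> wdeg b = 0 -> J (mono a * mono b - mono b * mono a).
Proof.
move=> /(ideal_word_subst [:: a; b]) + a0 b0.
have Xa : subst (word_subst [:: a; b]) (gX F 0 0) = mono a.
  exact: word_substX.
have Xb : subst (word_subst [:: a; b]) (gX F 0 1) = mono b.
  exact: word_substX.
by rewrite substB {1}substM Xa Xb substM Xa Xb.
Qed.

Lemma swap_in_ideal a b c : J (swap_identity F (wdeg a)) ->
    wdeg a = - wdeg b -> wdeg c = - wdeg b ->
  J (mono a * mono b * mono c - mono c * mono b * mono a).
Proof.
move=> /(ideal_word_subst [:: a; b; c]) + Da Dc.
have Xa : subst (word_subst [:: a; b; c]) (gX F (wdeg a) 0) = mono a.
  exact: word_substX.
have Xb : subst (word_subst [:: a; b; c]) (gX F (- wdeg a) 1) = mono b.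
  by apply: word_substX; rewrite Da opprK.
have Xc : subst (word_subst [:: a; b; c]) (gX F (wdeg a) 2) = mono c.
  by apply: word_substX; rewrite Da.
rewrite substB {1}substM Xc.
rewrite {1}substM Xa Xb.
rewrite {1}substM Xa.
by rewrite substM Xb Xc.
Qed.

(** The exchange in degree zero is a combination of commutators, see
    [swap_commutators]. *)
Lemma swap0_in_ideal : J (comm_identity F n) -> J (swap_identity F (0 : 'Z_n)).
Proof.
move=> Jcomm; rewrite /swap_identity oppr0.
have comm i j : J (gX F 0 i * gX F 0 j - gX F 0 j * gX F 0 i).
  rewrite /gX !mono_letter; apply: comm_in_ideal => //;
  by rewrite wdeg1.
set x := gX F 0 0; set y := gX F 0 1; set z := gX F 0 2.
rewrite (swap_commutators x y z).
apply: idealD; last exact/idealMl/comm.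
by apply: idealD; [apply/idealMl/comm | apply/idealMr/comm].
Qed.

Lemma swap_eq_in_ideal w w' :
    (forall t, J (swap_identity F t)) -> swap_eq (@fst 'Z_n nat) w w' ->
  J (mono w - mono w').
Proof.
move=> Jswap; elim=> [u|u a b c v u' Da Dc _ Jcba].
  by rewrite subrr -(scale0r (swap_identity F 0)); apply/idealZ.
rewrite -(subrKA (mono (u ++ c ++ b ++ a ++ v))); apply: idealD Jcba.
rewrite !mono_cat -swap_context; apply/idealMl/idealMr.
exact: swap_in_ideal.
Qed.

(** Words whose factors have the right degrees are substitution instances of
    the listed monomials. *)
Lemma monomial_in_ideal (d : 'I_n -> 'Z_n) ys v :
    J (multilinear_monomial F d) -> size ys = n ->
    (forall i : 'I_n, d i = wdeg (nth [::] ys i)) ->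
  J (mono (flatten ys ++ v)).
Proof.
move=> /(ideal_word_subst ys) + size_ys Dd; rewrite subst_prod.
rewrite mono_cat mono_flatten (big_nth [::]) big_mkord size_ys => Jys.
apply: idealMr; congr J: Jys; apply: eq_bigr => i _.
exact/word_substX/esym.
Qed.

End TIdeals.

Section Admissible.
Variable m : nat.
Local Notation n := m.+2.
Local Notation wdeg := (wdeg (@fst 'Z_n nat)).

Lemma ordinal_interval_sum (f : nat -> 'Z_n) r s : (s < n)%N ->
  \sum_(t < n | (r <= t <= s)%N) f t = partial_sum f r s.+1.
Proof.
move=> lt_sn; rewrite /partial_sum (big_nat_widenl r 0) //.
by rewrite (big_nat_widen 0 s.+1 n) // big_mkord.
Qed.

(** In terms of partial sums the intervals of length one are allowed as well:
    they repeat that the degrees, except the last, are not zero. *)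
Lemma admissible_partial_sum (f : nat -> 'Z_n) :
  admissible (fun i : 'I_n => f i) <->
  (forall i, (i < n)%N -> f i != 0) /\
  (forall r s, (r < s <= m.+1)%N -> partial_sum f r s != 0).
Proof.
split=> -[f0 f_sum]; split.
- by move=> i lt_in; apply: (f0 (Ordinal lt_in)).
- move=> r s /andP[].
  rewrite leq_eqVlt => /orP[/eqP<- le_rm|].
    by rewrite /partial_sum big_nat1; apply: (f0 (Ordinal (leqW le_rm))).
  case: s => // s lt_rs lt_sm.
  have lt_sn: (s < n)%N by apply: ltnW.
  have lt_rn: (r < n)%N by apply: ltn_trans lt_sn.
  rewrite -ordinal_interval_sum //.
  by apply: (f_sum (Ordinal lt_rn) (Ordinal lt_sn)); apply/andP; split.
- by move=> i; apply: f0.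
move=> r s /andP[lt_rs lt_sm]; rewrite ordinal_interval_sum //.
by apply: f_sum; rewrite lt_sm ltnS ltnW.
Qed.

(** The case of [covers_cut] in which no vertex has been seen yet. *)
Lemma covers_admissible w : covers (@fst 'Z_n nat) [::] 0 w ->
  exists ys v, [/\ w = flatten ys ++ v, size ys = n
    & admissible (fun i : 'I_n => wdeg (nth [::] ys i))].
Proof.
move=> covw; have [//||ys [v [-> size_ys ys0 _ ys_sum]]] :=
  covers_cut (k := m.+1) _ _ covw.
  by rewrite card_ord.
exists ys, v; split=> //.
apply/(admissible_partial_sum (fun t => wdeg (nth [::] ys t))); split=> // i lt_in.
by apply: ys0; rewrite mem_nth ?size_ys.
Qed.

End Admissible.

(** * Products of homogeneous block triangular matrices *)
Lemma natr_inj_pchar0 (F : fieldType) : [pchar F] =i pred0 ->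
  injective (fun k : nat => k%:R : F).
Proof.
move=> /pcharf0P char0; suff le_inj (j k : nat) : (j <= k)%N -> k%:R = j%:R :> F -> j = k.
  move=> j k eq_jk; case/orP: (leq_total j k) => le_jk; first exact: le_inj.
  exact/esym/le_inj.
move=> le_jk /eqP; rewrite -subr_eq0 -natrB // char0 subn_eq0 => le_kj.
by apply/eqP; rewrite eqn_leq le_jk.
Qed.

(** There is no room for a nonempty block longer than one letter, nor for
    anything around the blocks. *)
Lemma flatten_singletons (T : eqType) (u v w : seq T) ys :
    w = u ++ flatten ys ++ v -> [::] \notin ys -> (size w <= size ys)%N ->
  ys = [seq [:: x] | x <- w].
Proof.
have size_flatten zs : [::] \notin zs -> (size zs <= size (@flatten T zs))%N.
  elim: zs => //= -[|x z] zs IH; rewrite inE //= => /IH le_zs.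
  by rewrite ltnS size_cat (leq_trans le_zs) // leq_addl.
move=> -> ys0; have size_ys := size_flatten ys ys0; rewrite !size_cat => size_w.
have: (size (flatten ys) + (size u + size v) <= size (flatten ys) + 0)%N.
  by rewrite addn0 addnCA (leq_trans size_w).
rewrite leq_add2l leqn0 addn_eq0 !size_eq0 => /andP[/eqP u0 /eqP v0].
rewrite u0 v0 cats0 add0n addn0 /= in size_w *.
elim: ys ys0 size_w {size_ys u0 v0} => //= -[|x [|y z]] ys IH.
- by rewrite inE.
- by rewrite inE /= => ys0 size_w; rewrite -IH.
rewrite inE /= => /size_flatten size_ys.
rewrite size_cat => size_w.
have lt_w: (size z + size (flatten ys) < size ys)%N := size_w.
by have := leq_trans lt_w size_ys; rewrite ltnNge leq_addl.
Qed.

Section BlockTriangular.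
Variables (F : fieldType) (m : nat).
Local Notation n := m.+2.
Local Notation alg := (free_alg F n).
Local Notation mono := (@mono F (gvar n)).
Local Notation wdeg := (wdeg (@fst 'Z_n nat)).
Local Notation edges := (edges (@fst 'Z_n nat)).
Local Notation covers := (covers (@fst 'Z_n nat)).
Local Notation ids := (graded_identities (BT_grading F n)).
Implicit Types (t : 'Z_n) (i j : 'Z_n) (x : gvar n) (w : seq (gvar n)) (f : alg).
Implicit Types (a : gvar n -> 'M[F]_n).

(** The positions (i, j) at which the block triangular matrices of degree t may
    have nonzero entries, see [BT_gradingP]. *)
Definition arrow t i j := (j == i + t) && ((i == ord_max) ==> (j == i)).

(** The edges that can contribute to a product of block triangular matrices:
    all except the edges other than loops out of the last vertex. *)
Definition live (e : 'Z_n * gvar n) := arrow e.2.1 e.1 (e.1 + e.2.1).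

Lemma DV_gradingP t (M : 'M[F]_n) :
  reflect (forall i j, j != i + t -> M i j = 0) (M \in DV_grading F t).
Proof.
have dvE (i j : 'Z_n) : ((j : nat)%:R - (i : nat)%:R == t) = (j == i + t).
  by rewrite !natr_Zp subr_eq addrC.
apply: (iffP idP) => [/memv_sumP[v v_in ->] i j ijt|M0].
  rewrite summxE big1 // => p; rewrite dvE => Dp.
  have := v_in p; rewrite dvE => /(_ Dp)/vlineP[c ->].
  rewrite !mxE; have [Di|_] := eqVneq i p.1; last by rewrite mulr0.
  have [Dj|_] := eqVneq j p.2; last by rewrite mulr0.
  by rewrite Di Dj Dp in ijt.
rewrite [M]matrix_sum_delta pair_bigA /=; apply: memv_suml => p _.
have [Dp|p_t] := eqVneq (p.2 : 'Z_n) (p.1 + t); last first.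
  by rewrite M0 // scale0r mem0v.
apply: rpredZ; apply: (subvP (sumv_sup p _ (subvv _))); first by rewrite dvE Dp.
exact: memv_line.
Qed.

Lemma BT_gradingP t (M : 'M[F]_n) :
  BT_grading F n t M <-> forall i j, M i j != 0 -> arrow t i j.
Proof.
split=> [[BTM /DV_gradingP Mt] i j Mij | M_arrow].
  have Dj: j == i + t by apply: contraNT Mij => /Mt->.
  rewrite /arrow Dj; apply/implyP => /eqP Di; apply: contraNT Mij => ji.
  apply/eqP/BTM; first by rewrite Di.
  have: (j <= m.+1)%N by rewrite -ltnS ltn_ord.
  rewrite leq_eqVlt => /orP[/eqP Dj'|//].
  by case/eqP: ji; apply: val_inj; rewrite Di.
split=> /= [i j Di lt_j|].
  apply: contraTeq lt_j => /M_arrow/andP[_].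
  have ->: i = ord_max by apply: val_inj.
  by rewrite eqxx => /eqP->; rewrite ltnn.
by apply/DV_gradingP => i j; apply: contraNeq => /M_arrow/andP[].
Qed.

(** From the row i only one path has nonzero weight, the walk that reads w. *)
Lemma word_prod_entry a w i j : (forall x, BT_grading F n x.1 (a x)) ->
  (\prod_(x <- w) a x) i j =
    if j == i + wdeg w then \prod_(e <- edges i w) a e.2 e.1 (e.1 + e.2.1) else 0.
Proof.
move=> BTa; elim: w i => [|x w IHw] i.
  by rewrite !big_nil mxE wdeg_nil addr0 eq_sym; case: eqP.
rewrite big_cons mxE (bigD1 (i + x.1)) //= IHw [X in _ + X]big1 ?addr0 => [|k /negPf k_ix].
  by rewrite wdeg_cons addrA big_cons /=; case: ifP => _; rewrite ?mulr0.
have [->|/(BT_gradingP x.1 (a x)).1] := eqVneq (a x i k) 0; first by rewrite mul0r.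
by move=> /(_ (BTa x))/andP[]; rewrite k_ix.
Qed.

End BlockTriangular.

Section GradedIdentities.
Variables (F : fieldType) (m : nat).
Local Notation n := m.+2.
Local Notation alg := (free_alg F n).
Local Notation mono := (@mono F (gvar n)).
Local Notation wdeg := (wdeg (@fst 'Z_n nat)).
Local Notation edges := (edges (@fst 'Z_n nat)).
Local Notation covers := (covers (@fst 'Z_n nat)).
Local Notation live := (@live m).
Local Notation arrow := (@arrow m).
Local Notation ids := (graded_identities (BT_grading F n)).
Implicit Types (t : 'Z_n) (i j : 'Z_n) (x : gvar n) (w : seq (gvar n)) (f : alg).
Implicit Types (a : gvar n -> 'M[F]_n) (y : 'Z_n * gvar n -> F).

Lemma gsubst_ev a f : gsubst a f = ev a f.
Proof. by []. Qed.

Lemma liveE i x : live (i, x) = (i == ord_max) ==> (x.1 == 0).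
Proof. by rewrite /live /arrow /= eqxx -(subr_eq0 (i + x.1)) addrAC subrr add0r. Qed.

(** Walks from different vertices are translates of one another; so a dead edge
    on the walk from each i means, on the walk from 0, an edge other than
    a loop out of each vertex ord_max - i. *)
Lemma covers_live w :
  covers [::] 0 w <-> forall i, ~~ all live (edges i w).
Proof.
split=> [cov i | dead c _].
  have [//|x xw x0] := cov (ord_max - i).
  apply/allPn; exists (i + (ord_max - i), x).
    rewrite -[in edges i w](addr0 i) edges_shift.
    by apply/mapP; exists (ord_max - i, x).
  by rewrite liveE addrC subrK eqxx.
have /allPn[[p x]] := dead (ord_max - c).
rewrite -[in edges _ w](addr0 (_ - _)) edges_shift => /mapP[[q z] /= qzw [Dp Dx]].
rewrite liveE Dp Dx negb_imply => /andP[max_q z0].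
exists z => //; move: max_q.
by rewrite -[X in _ == X]addr0 -addrA (inj_eq (addrI _)) addrC subr_eq0 => /eqP<-.
Qed.

Lemma arrow_trans s t i k j : arrow s i k -> arrow t k j -> arrow (s + t) i j.
Proof.
rewrite /arrow => /andP[/eqP-> /implyP loop_i] /andP[/eqP-> /implyP loop_k].
rewrite addrA eqxx /=; apply/implyP => i_max; have /eqP Di := loop_i i_max.
by have:= loop_k; rewrite Di i_max => /(_ isT).
Qed.

Lemma BT_grading_word a w : (forall x, BT_grading F n x.1 (a x)) ->
  BT_grading F n (wdeg w) (\prod_(x <- w) a x).
Proof.
move=> BTa; elim: w => [|x w /BT_gradingP IHw]; apply/BT_gradingP => i j.
  rewrite big_nil mxE wdeg_nil /arrow addr0 [j == i]eq_sym.
  have [_|_] := eqVneq i j; first by rewrite implybT.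
  by rewrite mulr0n eqxx.
rewrite big_cons mxE wdeg_cons; apply: contraNT => arrow_ij.
apply/eqP/big1 => k _; apply/eqP; apply: contraNT arrow_ij.
rewrite mulf_eq0 negb_or => /andP[+ /IHw].
by move/(BT_gradingP x.1 (a x)).1: (BTa x) => BTax /BTax; apply: arrow_trans.
Qed.

(** For the invariance under endomorphisms: a degree-preserving endomorphism
    followed by a graded substitution is again a graded substitution. *)
Lemma ids_T_ideal : T_ideal ids.
Proof.
have mx_scaleAr (c : F) (M N : 'M[F]_n) : c *: (M * N) = M * (c *: N).
  exact: scalerAr.
split.
  split=> [a _|f g idf idg a BTa|h f idf a BTa|h f idf a BTa].
  - by rewrite gsubst_ev ev0.
  - by rewrite gsubst_ev evD -!gsubst_ev idf // idg // addr0.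
  - rewrite gsubst_ev (ev_is_multiplicative a mx_scaleAr).2 -!gsubst_ev.
    by rewrite idf // mulr0.
  - rewrite gsubst_ev (ev_is_multiplicative a mx_scaleAr).2 -!gsubst_ev.
    by rewrite idf // mul0r.
move=> phi phi_deg f idf a BTa; rewrite gsubst_ev (ev_comp a phi f mx_scaleAr).
rewrite -gsubst_ev; apply: idf => x; apply/BT_gradingP => i j.
apply: contraNT => arrow_ij; rewrite /ev summxE big_seq big1 // => w w_supp.
have hom_x: homogeneous x.1 (phi << fmu x >>).
  apply: phi_deg => u; rewrite mono_letter msupp_mono inE => /eqP->.
  by rewrite /mon_deg big_seq1.
have Dw: wdeg w = x.1 by apply: hom_x.
have /BT_gradingP BTw := BT_grading_word w BTa.
apply/eqP; rewrite mxE mulf_eq0; apply/orP; right.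
by apply: contraNT arrow_ij => /BTw; rewrite Dw.
Qed.

(** Every block triangular matrix of degree deg x has this form. *)
Definition generic y x : 'M[F]_n :=
  \matrix_(i, j) if arrow x.1 i j then y (i, x) else 0.

Lemma generic_BT y x : BT_grading F n x.1 (generic y x).
Proof. by apply/BT_gradingP => i j; rewrite mxE; case: ifP => //; rewrite eqxx. Qed.

Lemma generic_word_entry y w i j : (\prod_(x <- w) generic y x) i j =
  if (j == i + wdeg w) && all live (edges i w)
  then \prod_(e <- edges i w) y e else 0.
Proof.
rewrite word_prod_entry; last exact: generic_BT.
case: eqP => //= _; elim: (edges i w) => [|e s IHs]; first by rewrite !big_nil.
rewrite !big_cons IHs mxE -/(live e) -surjective_pairing /=.
by case: ifP; rewrite ?mul0r //; case: ifP; rewrite ?mulr0.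
Qed.

Lemma ids_mono w : ids (mono w) <-> covers [::] 0 w.
Proof.
split=> [idw|/covers_live dead a BTa]; last first.
  apply/matrixP => i j; rewrite gsubst_ev ev_mono word_prod_entry // mxE.
  case: eqP => // _; have /allPn[e ew dead_e] := dead i.
  apply/eqP; rewrite prodf_seq_eq0; apply/hasP; exists e => //=.
  apply: contraNT dead_e; move/(BT_gradingP e.2.1 (a e.2)).1: (BTa e.2).
  exact.
apply/covers_live => i; apply/negP => live_w.
have /matrixP/(_ i (i + wdeg w)) := idw _ (generic_BT (fun _ => 1)).
rewrite gsubst_ev ev_mono generic_word_entry eqxx live_w mxE big1 //.
by move/eqP; rewrite oner_eq0.
Qed.

(** Each edge is given as value the k-th power of its own prime, for every k.
    The entry at row i of the evaluation of f then becomes a power sum, over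
    the walks from i that stay alive and have the degree of w0, of the prime
    codes of their multisets of edges.  Characteristic zero keeps distinct
    codes distinct in F. *)
Lemma ids_class_sum f w0 i : [pchar F] =i pred0 -> ids f ->
    all live (edges i w0) ->
  \sum_(w <- msupp f | perm_eq (edges i w) (edges i w0)) f@_w = 0.
Proof.
move=> char0 idf live_w0; set j := i + wdeg w0.
pose c (w : {fmonom gvar n}) : F :=
  if (j == i + wdeg w) && all live (edges i w) then f@_w else 0.
pose v w : F := (prime_code (edges i w))%:R.
have vE w : (v w == v w0) = perm_eq (edges i w) (edges i w0).
  by rewrite (inj_eq (natr_inj_pchar0 char0)) prime_code_perm.
transitivity (\sum_(w <- msupp f | v w == v w0) c w).
  apply: eq_big => [w | w ww0]; first by rewrite vE.
  rewrite /c (perm_all _ ww0) live_w0 andbT.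
  by rewrite /j -(sum_edges _ i w0) -(perm_big _ ww0) sum_edges eqxx.
apply: power_sums_class_sum => k.
pose y (e : 'Z_n * gvar n) : F := (nth_prime (choice.pickle e))%:R ^+ k.
have: gsubst (generic y) f i j = 0 by rewrite (idf _ (generic_BT y)) mxE.
rewrite /gsubst summxE => sum0; rewrite -[RHS]sum0.
apply: eq_bigr => w _; rewrite mxE generic_word_entry /c.
case: ifP => _; rewrite ?mul0r ?mulr0 //; congr (_ * _).
by rewrite /v /prime_code natr_prod -prodrXl.
Qed.

End GradedIdentities.

(** * Generation of the graded identities *)
Section Generation.
Variables (F : fieldType) (m : nat).
Local Notation n := m.+2.
Local Notation alg := (free_alg F n).
Local Notation mono := (@mono F (gvar n)).
Local Notation wdeg := (wdeg (@fst 'Z_n nat)).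
Local Notation edges := (edges (@fst 'Z_n nat)).
Local Notation covers := (covers (@fst 'Z_n nat)).
Local Notation swap_eq := (swap_eq (@fst 'Z_n nat)).
Local Notation live := (@live m).
Local Notation ids := (graded_identities (BT_grading F n)).
Implicit Types (t : 'Z_n) (x : gvar n) (u v : seq (gvar n)) (f : alg).

(** The two products have the same entries, since these only depend on the
    multisets of edges. *)
Lemma ids_edges u v : (forall i : 'Z_n, perm_eq (edges i u) (edges i v)) ->
  ids (mono u - mono v).
Proof.
move=> eq_uv a BTa; rewrite gsubst_ev -scaleN1r evD evZ !ev_mono scaleN1r.
apply/matrixP => i j; rewrite !mxE !word_prod_entry //.
have ->: wdeg u = wdeg v.
  by rewrite -(sum_edges _ 0 u) (perm_big _ (eq_uv 0)) sum_edges.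
by rewrite (perm_big _ (eq_uv i)) subrr.
Qed.

Lemma swap_mono t : swap_identity F t =
  mono [:: (t, 0%N); (- t, 1%N); (t, 2%N)]
    - mono [:: (t, 2%N); (- t, 1%N); (t, 0%N)].
Proof. by rewrite /swap_identity /gX !mono_letter -!mono_cat. Qed.

Lemma comm_mono : comm_identity F n =
  mono [:: (0, 0%N); (0, 1%N)] - mono [:: (0, 1%N); (0, 0%N)].
Proof. by rewrite /comm_identity /gX !mono_letter -!mono_cat. Qed.

Definition letters (d : 'I_n -> 'Z_n) : seq (gvar n) :=
  [seq (d i, i : nat) | i <- enum 'I_n].

Lemma multilinear_mono d : multilinear_monomial F d = mono (letters d).
Proof.
by rewrite mono_prod /letters big_map enumT /multilinear_monomial [index_enum _]unlock.
Qed.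

Lemma ids_swap t : ids (swap_identity F t).
Proof.
rewrite swap_mono; apply: ids_edges => i.
apply: (@swap_step_edges _ _ _ i [::] [:: _] [:: _] [:: _] [::]);
  by rewrite !wdeg1 opprK.
Qed.

Lemma ids_comm : ids (comm_identity F n).
Proof.
rewrite comm_mono; apply: ids_edges => i.
apply: (@swap_step_edges _ _ _ i [::] [:: _] [::] [:: _] [::]);
  by rewrite wdeg1 wdeg_nil oppr0.
Qed.

Lemma size_letters d : size (letters d) = n.
Proof. by rewrite size_map size_enum_ord. Qed.

Lemma nth_letters d (i : 'I_n) : nth (0, 0%N) (letters d) i = (d i, i : nat).
Proof. by rewrite (nth_map ord0) ?size_enum_ord // nth_ord_enum. Qed.

Lemma letters_inj d d' :
  [seq x.1 | x <- letters d] = [seq x.1 | x <- letters d'] -> d =1 d'.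
Proof.
move=> eq_d i; have := congr1 (fun s => nth 0 s i) eq_d.
by rewrite !(nth_map (0, 0%N)) ?size_letters // !nth_letters.
Qed.

(** Admissibility says that no nonempty factor of the monomial that avoids the
    last letter has degree zero; whence the nonempty b. *)
Lemma admissible_infix d u a b : admissible d -> letters d = u ++ a ++ b ->
  a != [::] -> b != [::] -> wdeg a != 0.
Proof.
move=> [d0 d_sum] Dw; rewrite -!size_eq0 -(lt0n (size a)) -(lt0n (size b)) => a_gt0 b_gt0.
pose f k := (nth (0, 0%N) (letters d) k).1.
have /(admissible_partial_sum f)[_ adm] : admissible (fun i : 'I_n => f i).
  split=> [i | r s lt_rs]; first by rewrite /f nth_letters; apply: d0.
  have Df (k : 'I_n) : f k = d k by rewrite /f nth_letters.
  by rewrite (eq_bigr _ (fun k _ => Df k)); apply: d_sum.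
have size_uab : (size u + (size a + size b) = n)%N.
  by rewrite -!size_cat -Dw size_letters.
have -> : wdeg a = partial_sum f (size u) (size u + size a).
  rewrite (wdeg_nth _ (0, 0%N)) /partial_sum -[in RHS](add0n (size u)) big_addn.
  rewrite addKn; apply: eq_big_nat => k /andP[_ lt_ka].
  by rewrite /f Dw nth_cat ltnNge leq_addl /= addnK nth_cat lt_ka.
apply: adm; apply/andP; split; first by rewrite -[ltnLHS]addn0 ltn_add2l.
have lt_uan : (size u + size a < n)%N.
  by rewrite -[ltnRHS]size_uab addnA -[ltnLHS]addn0 ltn_add2l.
exact: lt_uan.
Qed.

(** If the walk covers, it cuts into n nonempty blocks, and since there are
    only n letters each block is a letter.  Conversely, an admissible walk
    departs from n distinct vertices, hence from all of them. *)
Lemma covers_letters d : covers [::] 0 (letters d) <-> admissible d.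
Proof.
split=> [/covers_admissible[ys [v [Dw size_ys [ys0 adm]]]] | adm c _].
  have Dys : ys = [seq [:: x] | x <- letters d].
    apply: (flatten_singletons (u := [::]) Dw); last by rewrite size_letters size_ys.
    apply/negP => /(nthP [::])[k]; rewrite size_ys => lt_kn Dk.
    by have /eqP[] := ys0 (Ordinal lt_kn); rewrite /= Dk wdeg_nil.
  have Dd (i : 'I_n) : wdeg (nth [::] ys i) = d i.
    by rewrite Dys (nth_map (0, 0%N)) ?size_letters // nth_letters wdeg1.
  split=> [i | r s lt_rs]; first by rewrite -Dd; apply: ys0.
  by rewrite -(eq_bigr _ (fun i _ => Dd i)); apply: adm.
pose p (i : 'I_n) : 'I_n := wdeg (take i (letters d)).
have inj_p : injective p.
  suff lt_inj (i j : 'I_n) : (i < j)%N -> p i != p j.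
    move=> i j eq_p; apply/eqP; apply: contraT => neq_ij.
    have [lt_ij|lt_ji|/val_inj eq_ij] := ltngtP i j.
    - by have := lt_inj _ _ lt_ij; rewrite eq_p eqxx.
    - by have := lt_inj _ _ lt_ji; rewrite eq_p eqxx.
    by rewrite eq_ij eqxx in neq_ij.
  move=> lt_ij; rewrite /p -(cat_take_drop i (take j (letters d))) wdeg_cat.
  rewrite take_takel ?(ltnW lt_ij) // eq_sym -subr_eq0 addrAC subrr add0r.
  apply: (admissible_infix (u := take i (letters d)) (b := drop j (letters d)) adm).
  - by rewrite -{1}(take_takel _ (ltnW lt_ij)) catA !cat_take_drop.
  - rewrite -size_eq0 size_drop size_takel; first by rewrite subn_eq0 -ltnNge.
    by rewrite size_letters; apply/ltnW/ltn_ord.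
  by rewrite -size_eq0 size_drop subn_eq0 -ltnNge size_letters.
have [q pK qK] := injF_bij inj_p; set i := q c.
exists (d i, i : nat); last by case: adm => d0 _; apply: d0.
have -> : letters d = take i (letters d) ++ (d i, i : nat) :: drop i.+1 (letters d).
  by rewrite -nth_letters -drop_nth ?size_letters // cat_take_drop.
by rewrite edges_cat mem_cat add0r inE -[wdeg _]/(p i) qK eqxx orbT.
Qed.

Lemma ids_multilinear d : ids (multilinear_monomial F d) <-> admissible d.
Proof. by rewrite multilinear_mono ids_mono covers_letters. Qed.

(** Induction on the size of the support of f.  If some monomial w0 of f is
    not an identity, then s is the part of f carried by the monomials with the
    edges of w0; the coefficients of this part add up to zero, so that it is
    a combination of differences w - w0 and lies in the ideal.  The polynomial
    f - s is an identity with smaller support. *)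
Lemma ids_in_ideal (J : set alg) f : [pchar F] =i pred0 -> T_ideal J ->
    (forall t, J (swap_identity F t)) ->
    (forall d : 'I_n -> 'Z_n, admissible d -> J (multilinear_monomial F d)) ->
  ids f -> J f.
Proof.
move=> char0 TJ Jswap Jmon.
have Tids := ids_T_ideal F m.
have [k] := ubnP (#|` msupp f|); elim: k f => // k IHk f le_fk idf.
have [/allP covered|] := boolP (all (fun w : {fmonom gvar n} =>
    [forall i : 'I_n, ~~ all live (edges i w)]) (msupp f)).
  rewrite [f]mono_expansion; apply: (ideal_sum TJ) => w fw.
  apply: (idealZ TJ); have /forallP/covers_live := covered w fw.
  case/covers_admissible => ys [v [-> size_ys adm]].
  exact: (monomial_in_ideal TJ v (Jmon _ adm)).
case/allPn => w0 fw0; rewrite negb_forall => /existsP[i].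
rewrite negbK => live_w0.
pose P (w : {fmonom gvar n}) := perm_eq (edges i w) (edges i w0).
pose s : alg := \sum_(w <- [seq w <- msupp f | P w]) f@_w *: (mono w - mono w0).
have s_in (J' : set alg) : T_ideal J' -> (forall t, J' (swap_identity F t)) -> J' s.
  move=> TJ' J'swap; apply: (ideal_sum TJ') => w.
  rewrite mem_filter => /andP[Pw _]; apply: (idealZ TJ').
  exact/(swap_eq_in_ideal TJ')/(eulerian_swap_eq Pw).
have sE : s = \sum_(w <- msupp f | P w) f@_w *: mono w.
  rewrite /s big_filter.
  exact: (sum_scale_shift _ _ (ids_class_sum char0 idf live_w0)).
have s_coeff w : s@_w = if P w then f@_w else 0.
  by rewrite sE; apply: mcoeff_restrict.
rewrite -(subrK s f); apply: (idealD TJ); last exact: s_in.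
have ids_s : ids s := s_in _ Tids ids_swap.
apply: (IHk _ _ (idealB Tids idf ids_s)); rewrite -ltnS.
apply: leq_trans le_fk; rewrite ltnS; apply: fproper_ltn_card; rewrite fproperE.
apply/andP; split.
  apply/fsubsetP => w; rewrite -2!mcoeff_neq0 mcoeffB s_coeff.
  by case: (P w); [rewrite subrr eqxx | rewrite subr0].
apply/negP => /fsubsetP/(_ w0 fw0); rewrite -mcoeff_neq0 mcoeffB s_coeff.
by rewrite /P perm_refl subrr eqxx.
Qed.

End Generation.

(** * Independence of the listed identities *)
Section CoefficientIdeals.
Variables (F : fieldType) (n : nat).
Local Notation alg := (free_alg F n).
Local Notation mono := (@mono F (gvar n)).
Local Notation wdeg := (wdeg (@fst 'Z_n nat)).
Implicit Types (t : 'Z_n) (x : gvar n) (u v w z : seq (gvar n)) (f p q : alg).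
Implicit Types (phi : {lrmorphism alg -> alg}).

(** The largest T-ideal all of whose members have coefficient zero at w. *)
Definition coef_ideal w : set alg :=
  [set f | forall phi, degree_preserving phi ->
     forall p q, (p * phi f * q)@_(FMonom w) = 0].

Lemma coef_ideal_T_ideal w : T_ideal (coef_ideal w).
Proof.
split.
  split=> [phi _ p q | f g Jf Jg phi phiD p q | h f Jf phi phiD p q
          | h f Jf phi phiD p q].
  - have -> : phi 0 = 0 by exact: raddf0.
    by rewrite mulr0 mul0r mcoeff0.
  - have -> : phi (f + g) = phi f + phi g by exact: raddfD.
    rewrite coeff_sandwichD -[RHS]addr0.
    by congr (_ + _); [apply: Jf | apply: Jg].
  - have -> : phi (h * f) = phi h * phi f by exact: rmorphM.
    by rewrite coeff_sandwichMl; apply: Jf.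
  have -> : phi (f * h) = phi f * phi h by exact: rmorphM.
  by rewrite coeff_sandwichMr; apply: Jf.
move=> psi psiD f Jf phi phiD p q.
apply: (Jf (phi \o psi : {lrmorphism alg -> alg})) => t g /psiD.
exact: phiD.
Qed.

Lemma coef_ideal_coeff w f : coef_ideal w f -> f@_(FMonom w) = 0.
Proof.
by move=> /(_ (idfun : {lrmorphism alg -> alg}) (fun _ _ h => h) 1 1);
  rewrite mul1r mulr1.
Qed.

(** Necessary condition for a product of variables of degrees ds to have
    a consequence with w in its support. *)
Definition factors (ds : seq 'Z_n) w :=
  exists u zs v, w = u ++ flatten zs ++ v /\ [seq wdeg z | z <- zs] = ds.

Lemma subst_word_factors phi p q xs w : degree_preserving phi ->
  FMonom w \in msupp (p * phi (mono xs) * q) -> factors [seq x.1 | x <- xs] w.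
Proof.
move=> phiD /msuppM_le[u1 [v [/msuppM_le[u [z [_ z_supp ->]]] _ Dw]]].
have {z_supp} : z \in msupp (\prod_(f <- [seq phi << fmu x >> | x <- xs]) f).
  by rewrite big_map -rmorph_prod -mono_prod.
case/msupp_prod => zs Dz zs_supp; exists u, zs, v; split.
  by rewrite -Dz catA -!fmM -Dw.
elim: xs zs zs_supp {Dz} => [|x xs IH] [|y zs] //= /andP[y_supp zs_supp].
rewrite IH //; congr (_ :: _); apply: (phiD _ _ _ _ y_supp) => s.
by rewrite mono_letter msupp_mono inE => /eqP->; rewrite /mon_deg big_seq1.
Qed.

Lemma coef_ideal_mono xs w : ~ factors [seq x.1 | x <- xs] w ->
  coef_ideal w (mono xs).
Proof.
move=> no_factors phi phiD p q; apply: mcoeff_outdom; apply/negP.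
by move/(subst_word_factors phiD).
Qed.

(** In [x_1, x_2] the constant terms of the substituted polynomials cancel, so
    that only nonempty factors of w have to be excluded. *)
Lemma coef_ideal_comm w :
    (forall u a b v, w = u ++ a ++ b ++ v -> a != [::] -> b != [::] ->
       wdeg a = 0 -> wdeg b <> 0) ->
  coef_ideal w (comm_identity F n).
Proof.
move=> no_factors phi phiD p q.
pose reduced k : alg := phi (gX F 0 k) - (phi (gX F 0 k))@_(FMonom [::]) *: 1.
have reduced_supp k (z : {fmonom gvar n}) : z \in msupp (reduced k) ->
    z != [::] :> seq _ /\ wdeg z = 0.
  move=> z_supp; split.
    apply: contraL z_supp => /eqP z0; rewrite -mcoeff_eq0 mcoeffB mcoeffZ.
    have -> : z = FMonom [::] by apply/eqP; rewrite fmP z0.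
    by rewrite -(mono_nil F (gvar n)) mono_coeff mulr1 subrr.
  suff: homogeneous 0 (reduced k) by apply.
  rewrite /reduced -scaleN1r scalerA; apply: homogeneousD.
    apply: phiD => s; rewrite /gX mono_letter msupp_mono inE => /eqP->.
    by rewrite /mon_deg big_seq1.
  apply: homogeneousZ => s; rewrite -(mono_nil F (gvar n)) msupp_mono inE => /eqP->.
  by rewrite /mon_deg big_nil.
have reduced_prod i j : (p * (reduced i * reduced j) * q)@_(FMonom w) = 0.
  apply: mcoeff_outdom; apply/negP.
  move=> /msuppM_le[s [v [/msuppM_le[u [r [_ /msuppM_le[a [b [a_s b_s ->]]] ->]]] _ Dw]]].
  have [a0 da] := reduced_supp _ _ a_s; have [b0 db] := reduced_supp _ _ b_s.
  apply: (no_factors u a b v) => //.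
  by rewrite -[w]/(fmonom_val (FMonom w)) Dw !fmM -!catA.
have -> : phi (comm_identity F n) =
    reduced 0%N * reduced 1%N - reduced 1%N * reduced 0%N.
  rewrite commutator_sub_scalar.
  have phiB f g : phi (f - g) = phi f - phi g by exact: raddfB.
  have phiM f g : phi (f * g) = phi f * phi g by exact: rmorphM.
  by rewrite [LHS]phiB; congr (_ - _); apply: phiM.
rewrite coeff_sandwichB -[RHS](subrr 0).
by congr (_ - _); apply: reduced_prod.
Qed.

(** Blocks of nonzero degree are nonempty; if there are as many of them as
    letters in w, each block is one letter. *)
Lemma factors_full ds w : factors ds w -> 0 \notin ds ->
  (size w <= size ds)%N -> ds = [seq x.1 | x <- w].
Proof.
case=> u [zs [v [Dw <-]]] ds0; rewrite size_map => le_w.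
rewrite (flatten_singletons Dw) //; last first.
  by apply: contra ds0 => zs0; apply/mapP; exists [::]; rewrite ?wdeg_nil.
by rewrite -map_comp; apply: eq_map => x /=; rewrite wdeg1.
Qed.

Lemma factors_degree0 ds w : factors ds w -> {in w, forall x, x.1 = 0} ->
  {in ds, forall t, t = 0}.
Proof.
case=> u [zs [v [Dw <-]]] w0 t /mapP[z zzs ->].
apply: wdeg_eq0 => x xz; apply: w0.
rewrite Dw !mem_cat; apply/orP; right; apply/orP; left.
by apply/flattenP; exists z.
Qed.

End CoefficientIdeals.

Section Bases.
Variables (F : fieldType) (m : nat).
Local Notation n := m.+2.
Local Notation alg := (free_alg F n).
Local Notation mono := (@mono F (gvar n)).
Local Notation wdeg := (wdeg (@fst 'Z_n nat)).
Local Notation ids := (graded_identities (BT_grading F n)).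
Hypothesis charF0 : [pchar F] =i pred0.
Implicit Types (S J : set alg) (t : 'Z_n) (d : 'I_n -> 'Z_n).

Lemma graded_basis_of S : S `<=` ids ->
    (forall J, T_ideal J -> S `<=` J ->
       (forall t, J (swap_identity F t)) /\
       (forall d, admissible d -> J (multilinear_monomial F d))) ->
  graded_basis (BT_grading F n) S.
Proof.
move=> S_ids S_gen; apply/seteqP; split=> f.
  by apply; [apply: ids_T_ideal | apply: S_ids].
move=> idf J TJ SJ; have [Jswap Jmon] := S_gen J TJ SJ.
exact: ids_in_ideal.
Qed.

(** A proper subset of S misses some f, and by hypothesis it lies in a T-ideal
    that does not contain f, although f is an identity. *)
Lemma minimal_graded_basis_of S : graded_basis (BT_grading F n) S ->
    (forall f, S f -> exists w, f@_(FMonom w) != 0 /\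
       forall s, S s -> s <> f -> coef_ideal w s) ->
  minimal_graded_basis (BT_grading F n) S.
Proof.
move=> basisS indep; split=> // S' [S'S SnS'] basisS'; apply: SnS' => f Sf.
apply: contrapT => S'nf; have [w [fw Jw]] := indep f Sf.
case/negP: fw; apply/eqP/coef_ideal_coeff.
have idf : T_ideal_gen S' f.
  rewrite [T_ideal_gen S']basisS' -basisS => J _; exact.
apply: idf; first exact: coef_ideal_T_ideal.
by move=> s S's; apply: Jw; [apply: S'S | move=> sf; rewrite -sf in S'nf].
Qed.

Lemma coef_ideal_multilinear d w :
  ~ factors [seq x.1 | x <- letters d] w ->
  coef_ideal w (multilinear_monomial F d).
Proof. by rewrite multilinear_mono; apply: coef_ideal_mono. Qed.

Lemma coef_ideal_swap t w : ~ factors [:: t; - t; t] w ->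
  coef_ideal w (swap_identity F t).
Proof.
move=> no_factors; rewrite swap_mono.
by apply: (idealB (@coef_ideal_T_ideal F n w)); apply: coef_ideal_mono.
Qed.

Lemma letters_neq0 d : admissible d -> 0 \notin [seq x.1 | x <- letters d].
Proof.
case=> d0 _; rewrite -map_comp; apply/negP => /mapP[i _ /= /esym/eqP].
exact/negP/d0.
Qed.

(** All factors of the word x_0 x_1 have degree zero, whereas the other
    identities involve variables of nonzero degree. *)
Lemma comm_independent s :
    (nonzero_swap_identities F n `|` monomial_identities F n) s ->
  coef_ideal [:: (0 : 'Z_n, 0%N); (0, 1%N)] s.
Proof.
have no_factors ds : ds != [::] -> 0 \notin ds ->
    ~ factors ds [:: (0 : 'Z_n, 0%N); (0, 1%N)].
  case: ds => // t ds _ + fac; rewrite inE negb_or => /andP[/eqP t0 _].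
  apply/t0/esym/(factors_degree0 fac); last by rewrite inE eqxx.
  by move=> x; rewrite !inE => /orP[] /eqP->.
case=> [[t /= t0 <-]|[d adm <-]].
  apply/coef_ideal_swap/no_factors => //.
  by rewrite !inE ![0 == _]eq_sym oppr_eq0 !negb_or !t0.
apply/coef_ideal_multilinear/no_factors; last exact: letters_neq0.
by rewrite -size_eq0 size_map size_letters.
Qed.

(** The commutator and the exchange identities would need a nonempty factor of
    degree zero before the last letter, which admissibility excludes, and the
    other monomials would have to match letter by letter. *)
Lemma monomial_independent d s : admissible d ->
    (comm_identities F n `|` nonzero_swap_identities F n
       `|` monomial_identities F n) s ->
  s <> multilinear_monomial F d -> coef_ideal (letters d) s.
Proof.
move=> adm [[->|[t /= t0 <-]]|[d' adm' <-]] neq_s.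
- apply: coef_ideal_comm => {neq_s} u a b v Dw a0 b0 /eqP.
  suff /negPf->: wdeg a != 0 by [].
  apply: (admissible_infix adm Dw a0).
  by case: (b) b0.
- apply: coef_ideal_swap => -[u [zs [v [Dw]]]].
  case: zs Dw => [|z1 [|z2 [|z3 [|? ?]]]] //= Dw [d1 d2 d3].
  suff : wdeg (z1 ++ z2) != 0 by rewrite wdeg_cat d1 d2 subrr eqxx.
  apply: (admissible_infix (u := u) (b := z3 ++ v) adm).
  - by rewrite Dw cats0 -!catA.
  - by case: z1 d1 {Dw} => //; rewrite wdeg_nil => Dt; rewrite -Dt eqxx in t0.
  by case: z3 d3 {Dw} => //; rewrite wdeg_nil => Dt; rewrite -Dt eqxx in t0.
apply: coef_ideal_multilinear => fac; apply: neq_s.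
rewrite !multilinear_mono; congr mono.
have /letters_inj eq_d : [seq x.1 | x <- letters d'] = [seq x.1 | x <- letters d].
  by apply: factors_full fac _ _; rewrite ?letters_neq0 // size_map !size_letters.
by apply: eq_map => i; rewrite eq_d.
Qed.

(** Here a nonempty factor of degree zero has at least two letters, and the
    commutator needs two such factors.  A listed monomial fits only when n = 3,
    and then its degrees t, - t, t are not admissible: this is where n = 2
    differs. *)
Lemma swap_independent t s : (3 <= n)%N -> t != 0 ->
    (comm_identities F n `|` nonzero_swap_identities F n
       `|` monomial_identities F n) s ->
  s <> swap_identity F t ->
  coef_ideal [:: (t, 0%N); (- t, 1%N); (t, 2%N)] s.
Proof.
move=> n_ge3 t0; set w := [:: _; _; _].
have w_neq0 x : x \in w -> x.1 != 0.
  by rewrite !inE => /or3P[] /eqP->; rewrite ?oppr_eq0.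
move=> [[->|[t' /= t'0 <-]]|[d adm <-]] neq_s.
- apply: coef_ideal_comm => {neq_s} u a b v Dw a0 b0 da db.
  have no_letter z : z != [::] -> {subset z <= w} -> wdeg z = 0 -> (1 < size z)%N.
    case: z => [|x [|? ?]] // _ zw; rewrite wdeg1 => /eqP.
    by have /negPf-> := w_neq0 x (zw x (mem_head _ _)).
  have a2 : (1 < size a)%N.
    by apply: no_letter => // x xa; rewrite Dw !mem_cat xa orbT.
  have b2 : (1 < size b)%N.
    by apply: no_letter => // x xb; rewrite Dw !mem_cat xb !orbT.
  have size_w : (3 = size u + (size a + (size b + size v)))%N.
    by rewrite -!size_cat -Dw.
  have : (4 <= 3)%N; last by [].
  rewrite [X in (_ <= X)%N]size_w; apply: leq_trans (leq_add a2 b2) _.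
  by rewrite [X in (_ <= _ + X)%N]addnA addnCA leq_addr.
- apply: coef_ideal_swap => fac; apply: neq_s.
  suff [-> _ _] : [:: t'; - t'; t'] = [seq x.1 | x <- w] by [].
  apply: (factors_full fac) => //.
  by rewrite !inE ![0 == _]eq_sym oppr_eq0 !negb_or !t'0.
apply: coef_ideal_multilinear => fac.
have Dd : [seq x.1 | x <- letters d] = [:: t; - t; t].
  by apply: factors_full fac _ _; rewrite ?letters_neq0 // size_map size_letters.
case El : (letters d) Dd => [|x [|y [|z l]]] //= [Dx Dy _ _].
suff : wdeg [:: x; y] != 0 by rewrite wdeg_cons wdeg1 Dx Dy subrr eqxx.
exact: (admissible_infix (u := [::]) (b := z :: l) adm).
Qed.

End Bases.

(** * Bases of graded identities *)
Section ListedIdentities.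
Variables (F : fieldType) (m : nat).
Local Notation n := m.+2.
Local Notation alg := (free_alg F n).
Local Notation ids := (graded_identities (BT_grading F n)).
Hypothesis charF0 : [pchar F] =i pred0.

Lemma full_list_ids :
  comm_identities F n `|` swap_identities F n `|` monomial_identities F n
    `<=` ids.
Proof.
move=> f [[->|[t _ <-]]|[d adm <-]]; first exact: ids_comm.
  exact: ids_swap.
exact/ids_multilinear.
Qed.

Lemma nonzero_swap_sub : nonzero_swap_identities F n `<=` swap_identities F n.
Proof. by move=> f [t _ <-]; exists t. Qed.

Lemma full_list_basis : graded_basis (BT_grading F n)
  (comm_identities F n `|` swap_identities F n `|` monomial_identities F n).
Proof.
apply: (graded_basis_of charF0); first exact: full_list_ids.
move=> J _ SJ; split=> [t|d adm]; apply: SJ; first by left; right; exists t.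
by right; exists d.
Qed.

Lemma reduced_list_basis : graded_basis (BT_grading F n)
  (comm_identities F n `|` nonzero_swap_identities F n
     `|` monomial_identities F n).
Proof.
apply: (graded_basis_of charF0).
  apply: subset_trans full_list_ids; apply: setSU; apply: setUS.
  exact: nonzero_swap_sub.
move=> J TJ SJ; split=> [t|d adm]; last by apply: SJ; right; exists d.
have [->|t0] := eqVneq t 0; last by apply: SJ; left; right; exists t.
by apply: (swap0_in_ideal TJ); apply: SJ; left; left.
Qed.

Lemma reduced_list_minimal : (3 <= n)%N ->
  minimal_graded_basis (BT_grading F n)
    (comm_identities F n `|` nonzero_swap_identities F n
       `|` monomial_identities F n).
Proof.
move=> n_ge3; apply: (minimal_graded_basis_of reduced_list_basis).
move=> f [[->|[t /= t0 <-]]|[d adm <-]].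
- exists [:: (0, 0%N); (0, 1%N)]; split.
    by rewrite comm_mono mcoeffB 2!mono_coeff eqxx subr0 oner_neq0.
  by move=> s [[->|Ss]|Ss] //; move=> _; apply: comm_independent; [left | right].
- exists [:: (t, 0%N); (- t, 1%N); (t, 2%N)]; split.
    by rewrite swap_mono mcoeffB 2!mono_coeff eqxx eqseq_cons xpair_eqE andbF subr0 oner_neq0.
  by move=> s Ss; apply: swap_independent.
exists (letters d); split.
  by rewrite multilinear_mono mono_coeff eqxx oner_neq0.
by move=> s Ss; apply: monomial_independent.
Qed.

End ListedIdentities.

Section SizeTwo.
Variable F : fieldType.
Hypothesis charF0 : [pchar F] =i pred0.

(** When n = 2, the two nonzero degrees t and - t form an admissible pair, so
    that both monomials of the exchange identity are consequences of the
    monomial identities. *)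
Lemma size2_basis : graded_basis (BT_grading F 2)
  (comm_identities F 2 `|` monomial_identities F 2).
Proof.
apply: (graded_basis_of charF0).
  by apply: subset_trans (@full_list_ids F 0); apply: setSU; left.
move=> J TJ SJ; split=> [t|d adm]; last by apply: SJ; right; exists d.
have [->|t0] := eqVneq t 0.
  by apply: (swap0_in_ideal TJ); apply: SJ; left.
have monomial_in i j k : J (mono F [:: (t, i); (- t, j); (t, k)]).
  pose ys := [:: [:: (t, i)]; [:: (- t, j)]].
  pose d (r : 'I_2) := wdeg (@fst 'Z_2 nat) (nth [::] ys r).
  have adm_d : admissible d.
    split=> [[[|[|//]] lt_r]|r s /andP[lt_rs]].
    - by rewrite /d /= wdeg1.
    - by rewrite /d /= wdeg1 oppr_eq0.
    by rewrite ltnS leqn0 => /eqP s0; rewrite s0 in lt_rs.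
  apply: (@monomial_in_ideal F 2 J TJ d ys [:: (t, k)]) => //.
  by apply: SJ; right; exists d.
by rewrite swap_mono; apply: (idealB TJ).
Qed.

Lemma size2_minimal : minimal_graded_basis (BT_grading F 2)
  (comm_identities F 2 `|` monomial_identities F 2).
Proof.
apply: (minimal_graded_basis_of size2_basis) => f [->|[d adm <-]].
  exists [:: (0, 0%N); (0, 1%N)]; split.
    by rewrite comm_mono mcoeffB 2!mono_coeff eqxx subr0 oner_neq0.
  by move=> s [->|Ss] //; move=> _; apply: comm_independent; right.
exists (letters d); split.
  by rewrite multilinear_mono mono_coeff eqxx oner_neq0.
move=> s [Ss|Ss]; apply: monomial_independent => //; first by left; left.
by right.
Qed.

End SizeTwo.

Theorem theorem19 (F : fieldType) (n : nat)
    (charF0 : [pchar F] =i pred0) (n_ge2 : (2 <= n)%N) :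
  [/\ (* the monomials in (3) are the multilinear monomial identities of degree n *)
      forall d : 'I_n -> 'Z_n,
        graded_identities (BT_grading F n) (multilinear_monomial F d)
        <-> admissible d,
      (* the graded identities of A follow from (1), (2), (3) *)
      graded_basis (BT_grading F n)
        (comm_identities F n `|` swap_identities F n
           `|` monomial_identities F n),
      (* minimality, once the redundant members of (2) are left out *)
      (3 <= n)%N ->
        minimal_graded_basis (BT_grading F n)
          (comm_identities F n `|` nonzero_swap_identities F n
             `|` monomial_identities F n)
    & n = 2%N ->
        minimal_graded_basis (BT_grading F n)
          (comm_identities F n `|` monomial_identities F n)].
Proof.
case: n n_ge2 => [|[|m]] // _; split.
- exact: ids_multilinear.
- exact: full_list_basis.
- exact: reduced_list_minimal.
by case=> ->; apply: size2_minimal.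
Qed.
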